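(* Let $\mathfrak{B}=\{B_1,\dots,B_m\}$ be a collection of $m$ patterns, none of which contains any other as a subpattern, and let $A=a_1\dots a_l$ be an initial pattern such that no $B_i$ is a subpattern of $a_1\dots a_{l-1}$. Let $\tau_i=\tau_{AB_i}$ be the waiting time for $B_i$ given $A$ to start with, let $\tau=\tau_{A\mathfrak{B}}=\min\{\tau_{AB_i}:1\le i\le m\}$, and for $0<\alpha<1$ let $g_\tau^j(\alpha)=E(\alpha^\tau\mathbf{1}_{\{\tau=\tau_j\}})$ for $1\le j\le m$, where $\mathbf{1}_{\{\tau=\tau_j\}}$ is the indicator function of the event $\{\tau=\tau_j\}$, and $Q_\tau(\alpha)=\frac{1-E(\alpha^\tau)}{1-\alpha}$. Then for every $i$ with $1\le i\le m$ and every $0<\alpha<1$, $$-Q_\tau(\alpha)+\sum_{j=1}^m (B_j\ast B_i)(\alpha)\,g_\tau^j(\alpha)=(A\ast B_i)(\alpha).$$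
   Context: Let $\xi$ be a discrete random variable whose set of possible values $\Sigma$ is called the alphabet, with $Pr(\xi=a)>0$ for every $a\in\Sigma$. Let $(\xi_n)_{n\ge1}$ be i.i.d. random letters with the same distribution as $\xi$. A pattern (word) $B$ of length $m$ is a finite ordered sequence of letters $b_1b_2\dots b_m$, $b_i\in\Sigma$; a subpattern of a word is a contiguous block (run) of consecutive letters in it. Waiting time: for an initial pattern $A=a_1\dots a_l$ and a pattern $B$ that is not a subpattern of $a_1\dots a_{l-1}$, put $\xi_0=a_l$ and $$\tau_{AB}=\min\{k\ge0: B \text{ is a subpattern of } a_1\dots a_{l-1}\xi_0\xi_1\dots\xi_k\}.$$ The case of no initial pattern, $A=\emptyset$ ($l=0$), is also allowed: then $\tau_{AB}$ is the least $k$ such that $B$ is a subpattern of $\xi_1\dots\xi_k$, and $A\ast B\equiv 0$. Correlation function: for a pattern $A=a_1\dots a_l$ let $A_{(k)}=a_1\dots a_k$ and $A^{(k)}=a_{l-k+1}\dots a_l$ be the subpatterns formed by its first and last $k$ letters, and $Pr(A)=Pr(\xi=a_1)\cdots Pr(\xi=a_l)$. Let $[A^{(k)}=B_{(k)}]$ be $1$ if $A^{(k)}=B_{(k)}$ and $0$ otherwise. For patterns $A$ of length $l$ and $B$ of length $m$, $$(A\ast B)(\alpha)=\sum_{k=1}^{\min\{l,m\}}\frac{[A^{(k)}=B_{(k)}]}{Pr(B_{(k)})\,\alpha^k}.$$ *)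

(* Defs.v *)
From HB Require Import structures.
From mathcomp Require Export all_boot all_order all_algebra finmap.
From mathcomp Require Export all_classical all_reals all_analysis.
Export Order.TTheory GRing.Theory Num.Theory.
Export numFieldNormedType.Exports.

Set Implicit Arguments.
Unset Strict Implicit.
Unset Printing Implicit Defensive.

Local Open Scope classical_set_scope.
Local Open Scope ring_scope.

Section iid.
Context d d' (Omega : measurableType d) (Sigma : measurableType d')
  (R : realType) (P : probability Omega R).

Definition mutually_independent (xi : nat -> {RV P >-> Sigma}) : Prop :=
  forall (J : {fset nat}) (E : nat -> set Sigma),
    (forall n, measurable (E n)) ->
    fine (P (\bigcap_(n in [set` J]) (xi n @^-1` E n))) =
    \prod_(n <- J) fine (P (xi n @^-1` E n)).

Definition same_distribution (X Y : Omega -> Sigma) : Prop :=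
  forall E : set Sigma, measurable E -> P (X @^-1` E) = P (Y @^-1` E).

Definition iid_copies (X : Omega -> Sigma) (xi : nat -> {RV P >-> Sigma}) :
    Prop :=
  mutually_independent xi /\ forall n, same_distribution (xi n) X.

End iid.

Section patterns.
Context d d' (Omega : measurableType d) (Sigma : measurableType d')
  (R : realType) (P : probability Omega R).
Implicit Types (X : Omega -> Sigma) (xi : nat -> Omega -> Sigma).
Implicit Types (A B : seq Sigma).

Definition letter_prob X (a : Sigma) : R := fine (P (X @^-1` [set a])).

Definition word_prob X B : R := \prod_(b <- B) letter_prob X b.

Definition correlation X A B (alpha : R) : R :=
  \sum_(1 <= k < (minn (size A) (size B)).+1)
    (drop (size A - k) A == take k B)%:R
      / (word_prob X (take k B) * alpha ^+ k).

(* The random letters are numbered from 0, so that [xi n] stands for the letter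
   usually written xi_(n+1), and [mkseq (fun n => xi n w) k] is the word
   xi_1 ... xi_k.  For A = a_1 ... a_l with l >= 1 and xi_0 = a_l, the word
   a_1 ... a_(l-1) xi_0 xi_1 ... xi_k is [A] followed by that word.  The
   infimum is +oo when B never occurs. *)
Definition waiting_time xi A B (w : Omega) : \bar R :=
  ereal_inf [set k%:R%:E |
    k in [set k : nat | infix B (A ++ mkseq (fun n => xi n w) k)]].

Definition waiting_time_coll xi A m (B : 'I_m -> seq Sigma) (w : Omega) :
    \bar R :=
  \big[Order.min/+oo%E]_(i < m) waiting_time xi A (B i) w.

(* alpha ^ t for 0 < alpha < 1, with alpha ^ +oo = 0; t = -oo does not occur. *)
Definition pow_time (alpha : R) (t : \bar R) : R :=
  if t is r%:E then alpha `^ r else 0.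

Definition pgf (tau : Omega -> \bar R) (alpha : R) : R :=
  fine 'E_P[fun w => pow_time alpha (tau w)].

Definition pgf_on (tau tauj : Omega -> \bar R) (alpha : R) : R :=
  fine 'E_P[fun w =>
    pow_time alpha (tau w) * \1_[set w' | tau w' = tauj w'] w].

Definition Qgf (tau : Omega -> \bar R) (alpha : R) : R :=
  (1 - pgf tau alpha) / (1 - alpha).

End patterns.

(* Main.v *)
Require Import Defs.
From mathcomp Require Import measurable_realfun zify ring lra.

(** The random text is A followed by the letters xi_1, xi_2, ...; positions in
    it are counted from the first letter of A, so that with l = |A| the time n
    of the theorem is the position l + n.  Everything rests on one event,
    studied for each position q >= 0: no pattern occurs in the first q letters
    of the text, and the b = |B_i| letters that follow spell B_i.  Its
    probability is computed in two ways.

    Forwards (occurrence_scaled_late, occurrence_scaled_early).  If q = l + n,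
    the letters that follow are independent of the past, and the probability is
    Pr(tau > n) Pr(B_i).  If q = l - k with 0 < k, nothing has occurred before q
    for certain, and B_i has to begin with the last k letters of A (so that k <= b,
    since B_i does not occur in a_1 ... a_(l-1)); divided by Pr(B_i), the probability is the coefficient of alpha^(-k) in A * B_i.

    Backwards (occurrence_decomposition, occurrence_scaledE).  On this event a
    pattern is completed for the first time at some position q + k with
    0 < k <= b, by exactly one B_j.  As the collection is reduced, B_j cannot
    lie inside B_i, so k <= |B_j| and the last k letters of B_j are the first k
    letters of B_i; what remains is the independent event that the next b - k
    letters complete B_i.  Divided by Pr(B_i), this is Pr(tau = tau_j = q + k - l)
    times the coefficient of alpha^(-k) in B_j * B_i.

    Multiplying by alpha^q and summing over all q >= 0 turns the forward
    computation into alpha^l (A * B_i + Q_tau) (occurrence_sum, cvg_Qgf) and the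
    backward one into alpha^l times the sum of the (B_j * B_i) g_j
    (cvg_hit_shift): no mass is lost in the shift by k because B_j cannot be
    completed before position |B_j| >= k.

    Two analytic points remain.  Expectations of alpha^tau are limits of finite
    sums over the values of tau (cvg_expectation_pow).  And X being discrete with
    all letters of positive probability makes the alphabet countable, so every
    set of words of a given length is a countable union of single words: this
    gives both the measurability of all the events above and the independence of
    past and future (segment_event_indep). *)

Set Implicit Arguments.
Unset Strict Implicit.
Unset Printing Implicit Defensive.

Local Open Scope classical_set_scope.
Local Open Scope ring_scope.

(** * Words read along a sequence *)

Section Segments.
Variable T : eqType.
Implicit Types (W : nat -> T) (w : seq T).

Definition segment W q r : seq T := [seq W k | k <- iota q r].

Lemma size_segment W q r : size (segment W q r) = r.
Proof. by rewrite size_map size_iota. Qed.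

Lemma segmentD W q r s :
  segment W q (r + s) = segment W q r ++ segment W (q + r) s.
Proof. by rewrite /segment iotaD map_cat. Qed.

Lemma take_segment W q r s : (s <= r)%N ->
  take s (segment W q r) = segment W q s.
Proof.
by move=> sr; rewrite -(subnKC sr) segmentD take_size_cat ?size_segment.
Qed.

Lemma drop_segment W q r s : (s <= r)%N ->
  drop s (segment W q r) = segment W (q + s) (r - s).
Proof.
by move=> sr; rewrite -{1}(subnKC sr) segmentD drop_size_cat ?size_segment.
Qed.

Lemma eq_segment W W' q q' r :
  (forall k, (k < r)%N -> W (q + k)%N = W' (q' + k)%N) ->
  segment W q r = segment W' q' r.
Proof.
move=> eqW; rewrite /segment -[q]addn0 -[q']addn0 !iotaDl -!map_comp.
by apply/eq_in_map => k; rewrite mem_iota => /andP[_ /eqW].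
Qed.

Lemma suffix_leq_size w1 w2 w : suffix w1 w -> suffix w2 w ->
  (size w1 <= size w2)%N -> suffix w1 w2.
Proof.
move=> s1 s2 le12; have le2 := size_suffix s2.
move: s1 s2; rewrite !suffixE => /eqP e1 /eqP e2.
by rewrite -[X in drop _ X]e2 drop_drop addnC addnBA// subnK// e1.
Qed.

Lemma segment_suffix W q r : suffix (segment W q r) (segment W 0 (q + r)).
Proof. by rewrite segmentD suffix_suffix. Qed.

End Segments.

(** * First hits of a reduced collection of patterns *)

Section FirstHit.
Variables (T : eqType) (m : nat) (B : 'I_m -> seq T).
Implicit Types (W : nat -> T) (w : seq T) (i j : 'I_m).

Definition avoids w : bool := [forall i, ~~ infix (B i) w].

(** Comparing [w] with its truncation by one letter, rather than scanning all its
    prefixes, is enough because avoidance passes to prefixes. *)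
Definition first_hit j w : bool :=
  infix (B j) w && avoids (take (size w).-1 w).

Lemma avoidsPn w : reflect (exists j, infix (B j) w) (~~ avoids w).
Proof.
rewrite negb_forall; apply: (iffP existsP) => -[j].
  by rewrite negbK; exists j.
by exists j; rewrite negbK.
Qed.

Lemma first_hit_segment W j n :
  first_hit j (segment W 0 n) =
  infix (B j) (segment W 0 n) && avoids (segment W 0 n.-1).
Proof. by rewrite /first_hit size_segment take_segment ?leq_pred. Qed.

Lemma infix_segment W b n k : (n <= k)%N ->
  infix b (segment W 0 n) -> infix b (segment W 0 k).
Proof. by move=> nk; rewrite -(subnKC nk) segmentD; apply: infix_catr. Qed.

Lemma avoids_segment W n k : (n <= k)%N ->
  avoids (segment W 0 k) -> avoids (segment W 0 n).
Proof.
move=> nk /forallP av; apply/forallP => i.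
by apply: contra (av i); apply: infix_segment.
Qed.

Hypothesis B_nil : forall i, B i != [::].

(** An occurrence that were not at the very end would already be visible one
    letter earlier.  Non-empty patterns are essential: the empty word is its own
    truncation. *)
Lemma first_hit_suffix W j n :
  first_hit j (segment W 0 n) -> suffix (B j) (segment W 0 n).
Proof.
rewrite first_hit_segment => /andP[]; case: n => [|n].
  by rewrite infixs0 (negbTE (B_nil j)).
rewrite [segment W 0 n.+1]mkseqS infix_rconsl => /orP[//|bi] /forallP/(_ j).
by rewrite bi.
Qed.

Lemma first_hit_time W j j' n n' : first_hit j (segment W 0 n) ->
  first_hit j' (segment W 0 n') -> n = n'.
Proof.
wlog : j j' n n' / (n <= n')%N.
  move=> H; have [/H|/ltnW/H h] := leqP n n'; first exact.
  by move=> h1 h2; rewrite (h _ _ h2 h1).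
rewrite leq_eqVlt => /orP[/eqP//|nn'].
rewrite !first_hit_segment => /andP[bn _] /andP[_ /forallP/(_ j)].
by rewrite (infix_segment _ bn)//; lia.
Qed.

Hypothesis B_reduced : forall i j, i != j -> ~~ infix (B i) (B j).

(** Two patterns completed by the same letter are both suffixes of the text, so
    the shorter one would be contained in the longer one. *)
Lemma first_hit_pattern W j j' n : first_hit j (segment W 0 n) ->
  first_hit j' (segment W 0 n) -> j = j'.
Proof.
move=> /first_hit_suffix h /first_hit_suffix h'; apply/eqP.
wlog jj' : j j' h h' / (size (B j) <= size (B j'))%N.
  move=> H; have [/H|/ltnW/H h1] := leqP (size (B j)) (size (B j')); first exact.
  by rewrite eq_sym h1.
apply: contraT => /B_reduced/negP; case; apply: suffixW.
exact: suffix_leq_size h h' jj'.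
Qed.

(** Scanning the text letter by letter: once some pattern has occurred after
    position n, the first position where one does is a first hit. *)
Lemma first_hit_before W n k : avoids (segment W 0 n) ->
  ~~ avoids (segment W 0 (n + k)) ->
  exists j r, [/\ (0 < r <= k)%N & first_hit j (segment W 0 (n + r))].
Proof.
elim: k => [|k IH] av; first by rewrite addn0 av.
have [av' /avoidsPn[j bj]|nav _] := boolP (avoids (segment W 0 (n + k))).
  exists j, k.+1; rewrite leqnn; split => //.
  by rewrite first_hit_segment bj addnS.
have [j [r [/andP[r0 rk] hj]]] := IH av nav.
by exists j, r; rewrite r0 (leqW rk).
Qed.

(** The disjoint alternative at position n, written with indicators so that it
    passes directly to probabilities: the patterns are still avoided, or exactly
    one of them has just appeared.  At n = 0 the truncation is the empty word
    itself, in which no pattern appears. *)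
Lemma first_hit_sum W n :
  (avoids (segment W 0 n.-1) : nat) =
  (avoids (segment W 0 n) + \sum_(j < m) first_hit j (segment W 0 n))%N.
Proof.
have [hj|nohit] := boolP [exists j, first_hit j (segment W 0 n)].
  have [j hj'] := existsP hj.
  rewrite (bigD1 j)//= hj' big1 => [|j' jj']; last first.
    by apply/eqP; rewrite eqb0; apply: contraNN jj' => /first_hit_pattern/(_ hj')->.
  have := hj'; rewrite first_hit_segment => /andP[bj ->].
  suff -> : avoids (segment W 0 n) = false by [].
  by apply/negbTE/avoidsPn; exists j.
have {}nohit j : first_hit j (segment W 0 n) = false.
  by apply/negbTE; apply: contra nohit => hj; apply/existsP; exists j.
rewrite big1 => [|j _]; last by rewrite nohit.
rewrite addn0; have [av|] := boolP (avoids (segment W 0 n)).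
  by rewrite (avoids_segment (leq_pred n) av).
move=> /avoidsPn[j bj]; have := nohit j.
by rewrite first_hit_segment bj /= => ->.
Qed.

(** If no pattern occurs before position q and [B i] is spelled from there on,
    then the first hit falls inside this copy of [B i], after its k-th letter
    say, and exactly one pair (j, k) contributes to the sum.  The pattern [B j]
    that is hit reaches back to q or beyond, for otherwise it would lie inside
    [B i] (or be [B i] itself, with k > |B i|); hence k <= |B j|. *)
Lemma occurrence_decomposition W i q :
  let b := size (B i) in
  (avoids (segment W 0 q) && (segment W q b == B i) : nat) =
  (\sum_(j < m) \sum_(1 <= k < (minn (size (B j)) b).+1)
    [&& first_hit j (segment W 0 (q + k)),
        drop (size (B j) - k) (B j) == take k (B i) &
        segment W (q + k) (b - k) == drop k (B i)])%N.
Proof.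
move=> b; set L := (_ && _); pose F j k := [&& first_hit j (segment W 0 (q + k)),
  drop (size (B j) - k) (B j) == take k (B i) &
  segment W (q + k) (b - k) == drop k (B i)].
under eq_bigr do under eq_bigr do rewrite -/(F _ _).
have FL j k : (0 < k <= minn (size (B j)) b)%N -> F j k -> L.
  rewrite leq_min => /and3P[k0 kj kb] /and3P[hj /eqP bji /eqP bi].
  rewrite /L -{1}(subnKC kb) segmentD bi.
  have -> : segment W q k = take k (B i).
    rewrite -bji; apply/esym/eqP; rewrite -[k in drop (_ - k)](size_segment W q) -suffixE.
    apply: suffix_leq_size (segment_suffix _ _ _) (first_hit_suffix hj) _.
    by rewrite size_segment.
  rewrite cat_take_drop eqxx andbT.
  move: hj; rewrite first_hit_segment => /andP[_]; apply: avoids_segment; lia.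
have [L1|L0] := boolP L; last first.
  rewrite big1// => j _; rewrite big_nat_cond big1// => k /andP[kj _].
  by apply/eqP; rewrite eqb0; apply: contra L0; apply: FL.
have /andP[av /eqP bi] := L1.
have [|j [k [/andP[k0 kb] hj]]] := @first_hit_before W q b av.
  by apply/avoidsPn; exists i; rewrite segmentD bi; apply: suffixW (suffix_suffix _ _).
have bik : segment W q k = take k (B i) by rewrite -bi take_segment.
(* A pattern shorter than k would lie inside the first k letters of B i. *)
have kj : (k <= size (B j))%N.
  rewrite leqNgt; apply/negP => jk.
  have bsuf : suffix (B j) (take k (B i)).
    rewrite -bik; apply: suffix_leq_size (first_hit_suffix hj) (segment_suffix _ _ _) _.
    by rewrite size_segment ltnW.
  have [ji|/B_reduced/negP[]] := eqVneq j i.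
    by move: jk; rewrite ji ltnNge kb.
  by apply: infix_trans (suffixW bsuf) (infix_take _ _).
have Fjk : F j k.
  apply/and3P; split => //; last by rewrite -bi drop_segment.
  rewrite -bik -[k in drop (_ - k)](size_segment W q) -suffixE.
  apply: suffix_leq_size (segment_suffix _ _ _) (first_hit_suffix hj) _.
  by rewrite size_segment.
(* The position and then the pattern of a first hit are unique. *)
have uniqF j' k' : F j' k' -> j' = j /\ k' = k.
  move=> /and3P[hj' _ _]; have kk := first_hit_time hj' hj.
  have {}kk : k' = k by lia.
  by split=> //; apply: first_hit_pattern hj' _; rewrite kk.
rewrite (bigD1 j)//= (bigD1_seq k) ?iota_uniq//=; last first.
  by rewrite mem_index_iota k0 ltnS leq_min kj kb.
rewrite Fjk !big1//.
- by move=> j' jj'; rewrite big1// => k' _; apply/eqP; rewrite eqb0;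
    apply: contraNN jj' => /uniqF[->].
- by move=> k' kk'; apply/eqP; rewrite eqb0; apply: contraNN kk' => /uniqF[_ ->].
Qed.

End FirstHit.

(** * Probabilities and expectations of exclusive events *)

Section Prob.
Context d (Omega : measurableType d) (R : realType) (P : probability Omega R).
Implicit Types (p q : Omega -> bool).

(** Boolean events, with real probabilities: pointwise identities between
    indicators can then be stated and proved by boolean reasoning. *)
Definition prob p : R := fine (P [set w | p w]).

Lemma probK p : measurable [set w | p w] -> P [set w | p w] = (prob p)%:E.
Proof. by move=> mp; rewrite /prob fineK// fin_num_measure. Qed.

Lemma eq_prob p q : p =1 q -> prob p = prob q.
Proof.
move=> pq; rewrite /prob (_ : [set w | p w] = [set w | q w])//.
by apply/seteqP; split=> w /=; rewrite pq.
Qed.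

Lemma prob_true p : (forall w, p w) -> prob p = 1.
Proof.
move=> pT; rewrite /prob (_ : [set w | p w] = setT) ?probability_setT//.
by apply/seteqP; split=> w /=.
Qed.

Lemma prob_false p : (forall w, ~~ p w) -> prob p = 0.
Proof.
move=> pF; rewrite /prob (_ : [set w | p w] = set0) ?measure0//.
by apply/seteqP; split=> w //=; rewrite (negbTE (pF w)).
Qed.

Lemma prob_ge0 p : 0 <= prob p.
Proof. exact: fine_ge0. Qed.

Lemma prob_le1 p : measurable [set w | p w] -> prob p <= 1.
Proof. by move=> mp; rewrite -lee_fin -probK// probability_le1. Qed.

(** Finite additivity in the form in which the combinatorial identities
    deliver it: an indicator that is a sum of indicators forces these to be
    pairwise exclusive. *)
Lemma prob_sum (I : Type) (r : seq I) p (h : I -> Omega -> bool) :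
  (forall i, measurable [set w | h i w]) ->
  (forall w, (p w : nat) = (\sum_(s <- r) h s w)%N) ->
  prob p = \sum_(s <- r) prob (h s).
Proof.
move=> mh; suff H : (forall w, (p w : nat) = (\sum_(s <- r) h s w)%N) ->
    measurable [set w | p w] /\ prob p = \sum_(s <- r) prob (h s).
  by move=> /H[].
elim: r p => [|i r IH] p hp.
  have {}hp w : ~~ p w by move: (hp w); rewrite big_nil; case: (p w).
  rewrite big_nil prob_false//; split => //.
  rewrite (_ : [set _ | _] = set0)//; apply/seteqP.
  by split=> w //=; rewrite (negbTE (hp w)).
have hp' w : ((p w && ~~ h i w) : nat) = (\sum_(s <- r) h s w)%N.
  move: (hp w); rewrite big_cons; case: (p w); case: (h i w) => /=; lia.
have [mp' ep'] := IH _ hp'.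
have pU : [set w | p w] = [set w | h i w] `|` [set w | p w && ~~ h i w].
  apply/seteqP; split=> w /=.
    by case: (h i w) => ->; [left|right].
  case=> [hi|/andP[]//].
  by move: (hp w); rewrite big_cons hi; case: (p w).
have mp : measurable [set w | p w] by rewrite pU; apply: measurableU.
split => //; rewrite big_cons -ep'; apply: EFin_inj.
rewrite EFinD -!probK// pU measureU//.
by apply/seteqP; split=> w //= [-> /andP[]].
Qed.

Lemma measurable_andb p q : measurable [set w | p w] ->
  measurable [set w | q w] -> measurable [set w | p w && q w].
Proof.
move=> mp mq; rewrite (_ : [set _ | _] = [set w | p w] `&` [set w | q w]).
  exact: measurableI.
by apply/seteqP; split=> w /=; [move/andP|case=> -> ->].
Qed.

(** If [h n] is the event that a random time equals n, then [f] is alpha to the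
    power of this time (0 when it is infinite).  Pointwise at most one term of
    the sum is non-zero, so the partial sums are eventually constant and bounded
    by 1, and dominated convergence applies; measurability of [f] comes for free
    as it is a pointwise limit. *)
Lemma cvg_expectation_pow (h : nat -> Omega -> bool) (f : Omega -> R) (alpha : R) :
  0 < alpha < 1 ->
  (forall n, measurable [set w | h n w]) ->
  (forall w n k, h n w -> h k w -> n = k) ->
  (forall w n, h n w -> f w = alpha ^+ n) ->
  (forall w, (forall n, ~~ h n w) -> f w = 0) ->
  (\sum_(0 <= n < N) alpha ^+ n * prob (h n)) @[N --> \oo] --> fine ('E_P[f])%E.
Proof.
move=> /andP[a0 a1] mh hinj fh f0.
pose F N w := \sum_(0 <= n < N) alpha ^+ n * \1_[set w | h n w] w.
have FE N w n : h n w -> F N w = if (n < N)%N then alpha ^+ n else 0.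
  move=> hn; rewrite /F.
  have E k : alpha ^+ k * \1_[set w | h k w] w = if k == n then alpha ^+ n else 0 :> R.
    case: eqVneq => [->|kn]; first by rewrite indicE mem_set// mulr1.
    by rewrite indicE memNset ?mulr0// => /= /(hinj _ _ _ hn) /esym/eqP; apply/negP.
  under eq_bigr do rewrite E.
  by rewrite -big_mkcond /= (big_nat1_eq +%R (fun=> alpha ^+ n)).
have F0 N w : (forall n, ~~ h n w) -> F N w = 0.
  move=> nh; rewrite /F big1// => n _.
  by rewrite indicE memNset ?mulr0//=; apply/negP.
have Fcvg w : F N w @[N --> \oo] --> f w.
  have [[n hn]|nh] := pselect (exists n, h n w).
    apply: cvg_near_cst; near=> N.
    rewrite (FE _ _ _ hn) (fh _ _ hn); suff -> : (n < N)%N by [].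
    by near: N; exists n.+1.
  have {}nh n : ~~ h n w by apply/negP => hn; apply: nh; exists n.
  by rewrite (f0 _ nh); apply: cvg_near_cst; near=> N; rewrite F0.
have mF N : measurable_fun setT (F N).
  by apply: measurable_sum => n; apply: measurable_funM.
have mf : measurable_fun setT f.
  by apply: (measurable_realfun.measurable_fun_cvg mF) => w _; apply: Fcvg.
have Fle N w : `|F N w| <= 1.
  have [[n hn]|nh] := pselect (exists n, h n w).
    rewrite (FE _ _ _ hn); case: ifP => _; last by rewrite normr0.
    by rewrite ger0_norm ?exprn_ge0 ?exprn_ile1 ?ltW.
  have {}nh n : ~~ h n w by apply/negP => hn; apply: nh; exists n.
  by rewrite F0// normr0.
have [|||||If _ cI] := @dominated_convergence _ _ _ P setT measurableT
    (fun N w => (F N w)%:E) (EFin \o f) (cst 1%E).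
- by move=> N; apply/measurable_EFinP.
- exact/measurable_EFinP.
- by apply: aeW => w _; apply: cvg_EFin => //; [near=> N|exact: Fcvg].
- exact: finite_measure_integrable_cst.
- by apply: aeW => w N _ /=; rewrite lee_fin.
have IF N : (\int[P]_w (F N w)%:E = (\sum_(0 <= n < N) alpha ^+ n * prob (h n))%:E)%E.
  rewrite /F; under eq_integral do rewrite -sumEFin.
  rewrite ge0_integral_sum//.
  - rewrite -sumEFin; apply: eq_bigr => n _.
    under eq_integral do rewrite EFinM.
    rewrite ge0_integralZl_EFin ?exprn_ge0 ?ltW//.
      by rewrite integral_indic// setIT EFinM; congr (_ * _)%E; apply: probK.
    exact: measurableT_comp.
  - move=> n; apply/measurable_EFinP/measurable_funM => //; exact: measurable_indic.
  - by move=> n w _; rewrite lee_fin mulr_ge0// exprn_ge0// ltW.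
have -> : (fun N => \sum_(0 <= n < N) alpha ^+ n * prob (h n)) =
    fine \o (fun N => \int[P]_w (F N w)%:E)%E.
  by apply/funext => N /=; rewrite IF.
apply: fine_cvg; rewrite fineK; first by rewrite unlock.
by rewrite unlock; apply: integrable_fin_num.
Unshelve. all: by end_near.
Qed.

End Prob.

(** * Words of independent letters *)

Section Letters.
Context (d d' : measure_display) (Omega : measurableType d)
  (Sigma : measurableType d') (R : realType) (P : probability Omega R).
Hypothesis mSigma : forall a : Sigma, measurable [set a].
Variables (X : {dRV P >-> Sigma}) (xi : nat -> {RV P >-> Sigma}).
Hypothesis X_gt0 : forall a : Sigma, (0 < P (X @^-1` [set a]))%E.
Hypothesis xi_iid : iid_copies X xi.

Notation letters w := (fun k => xi k w).

(** Every letter is a value of X, for otherwise it would have probability 0;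
    and X has countable range. *)
Lemma countable_alphabet : countable [set: Sigma].
Proof.
suff <- : range X = [set: Sigma] by apply: countable_range.
apply/seteqP; split => // a _; apply: contrapT => aX.
have := X_gt0 a; rewrite (_ : X @^-1` [set a] = set0) ?measure0 ?ltxx//.
by apply/seteqP; split => // w /= Xwa; apply: aX; exists w.
Qed.

Lemma letter_prob_gt0 a : 0 < letter_prob P X a.
Proof.
by rewrite /letter_prob fine_gt0// X_gt0 -ge0_fin_numE// fin_num_measure//;
  apply: measurable_funPTI.
Qed.

Lemma word_prob_gt0 v : 0 < word_prob P X v.
Proof. by apply: prodr_gt0 => a _; apply: letter_prob_gt0. Qed.

Lemma word_prob_cat u v :
  word_prob P X (u ++ v) = word_prob P X u * word_prob P X v.
Proof. exact: big_cat. Qed.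

Lemma measurable_letter k a : measurable [set w | xi k w == a].
Proof.
rewrite (_ : [set _ | _] = xi k @^-1` [set a]).
  exact: measurable_funPTI.
by apply/seteqP; split => w /= /eqP.
Qed.

Lemma measurable_segment_eq s r v :
  measurable [set w | segment (letters w) s r == v].
Proof.
elim: r s v => [|r IH] s [|a v].
- by rewrite (_ : [set _ | _] = setT)//; apply/seteqP; split.
- by rewrite (_ : [set _ | _] = set0)//; apply/seteqP; split.
- by rewrite (_ : [set _ | _] = set0)//; apply/seteqP; split.
rewrite (_ : [set _ | _] =
    [set w | (xi s w == a) && (segment (letters w) s.+1 r == v)]).
  by apply: measurable_andb; [exact: measurable_letter | exact: IH].
by apply/seteqP; split => w.
Qed.

(** Mutual independence for the index set s, ..., s + |v| - 1 and the
    singletons of the letters of v. *)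
Lemma prob_segment s v :
  prob P (fun w => segment (letters w) s (size v) == v) = word_prob P X v.
Proof.
have [indep ident] := xi_iid.
pose J := [fset k in iota s (size v)]%fset.
have := @indep J (fun k => [set nth point v (k - s)]) (fun k => mSigma _).
have memJ k : (k \in J) = (s <= k < s + size v)%N.
  by rewrite !inE mem_iota.
rewrite (_ : \bigcap_(k in [set` J]) _ =
    [set w | segment (letters w) s (size v) == v]); last first.
  apply/seteqP; split => w /= H.
    apply/eqP/(@eq_from_nth _ point); rewrite ?size_segment// => k kv.
    rewrite (nth_map 0%N) ?size_iota// nth_iota//.
    have /= -> : (xi (s + k)%N @^-1` [set nth point v (s + k - s)]) w.
      by apply: H; rewrite /= memJ leq_addr ltn_add2l.
    by rewrite addKn.
  move=> k; rewrite /= memJ => /andP[sk ks].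
  have kv : (k - s < size v)%N by rewrite ltn_subLR.
  by rewrite -[X in nth _ X](eqP H) (nth_map 0%N) ?size_iota// nth_iota ?subnKC.
rewrite -/(prob _ _) => ->.
transitivity (\prod_(k <- iota s (size v)) letter_prob P X (nth point v (k - s))).
  transitivity (\prod_(k <- J) letter_prob P X (nth point v (k - s))).
    by apply: eq_bigr => k _; congr fine; apply: ident.
  apply/perm_big/uniq_perm; rewrite ?fset_uniq ?iota_uniq// => k.
  by rewrite memJ mem_iota.
have -> : iota s (size v) = map (addn s) (iota 0 (size v)).
  by rewrite -iotaDl addn0.
rewrite /word_prob [RHS](big_nth point) big_map /index_iota subn0.
by apply: eq_bigr => k _; rewrite addKn.
Qed.

Lemma word_encoding :
  exists enc : seq Sigma -> nat, injective enc.
Proof.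
have /countable_injP[f finj] := countable_alphabet.
exists (fun v => choice.pickle (map f v)) => u v.
move=> /(pcan_inj choice.pickleK)/inj_map; apply.
by move=> a b; apply: finj; rewrite inE.
Qed.

(** Words of length n are countably many, so any event about the first n letters
    splits into countably many events fixing these letters.  A product formula
    for single words therefore extends to arbitrary sets of words. *)
Lemma segment_event_indep (n : nat) (D : pred (seq Sigma)) (q : Omega -> bool) (c : R) :
  measurable [set w | q w] ->
  (forall v, size v = n ->
     prob P (fun w => (segment (letters w) 0 n == v) && q w) =
     prob P (fun w => segment (letters w) 0 n == v) * c) ->
  measurable [set w | D (segment (letters w) 0 n)] /\
  prob P (fun w => D (segment (letters w) 0 n) && q w) =
    prob P (fun w => D (segment (letters w) 0 n)) * c.
Proof.
move=> mq qc; have [enc enc_inj] := word_encoding.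
(* G k p is p restricted to the single word of code k, if there is one. *)
pose G (k : nat) (p : Omega -> bool) := [set w |
  [&& enc (segment (letters w) 0 n) == k, D (segment (letters w) 0 n) & p w]].
have GE k : (forall p, G k p = set0) \/ exists2 v, size v = n &
    forall p, G k p = [set w | (segment (letters w) 0 n == v) && p w].
  have [[v [Dv vn vk]]|nv] := pselect (exists v, [/\ D v, size v = n & enc v = k]).
    right; exists v => // p; apply/seteqP; split => w /=.
      by move=> /and3P[]; rewrite -vk => /eqP/enc_inj -> _ ->; rewrite eqxx.
    by rewrite /G/=; move=> /andP[/eqP -> ->]; rewrite vk eqxx Dv.
  left => p; rewrite -subset0 => w /= /and3P[/eqP ek Dw _]; apply: nv.
  by exists (segment (letters w) 0 n); rewrite size_segment.
have mG k (p : Omega -> bool) : measurable [set w | p w] -> measurable (G k p).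
  move=> mp; have [->//|[v _ ->]] := GE k.
  exact/measurable_andb/mp/measurable_segment_eq.
have tG p : trivIset setT (G^~ p).
  by move=> k k' _ _ [w [/= /andP[/eqP <- _] /andP[/eqP <- _]]].
have UG p : [set w | D (segment (letters w) 0 n) && p w] = \bigcup_k G k p.
  apply/seteqP; split => w /=.
    by move=> Dp; exists (enc (segment (letters w) 0 n)); rewrite /G/= ?eqxx.
  by move=> [k _ /= /andP[]].
have PG (p : Omega -> bool) : measurable [set w | p w] ->
    P [set w | D (segment (letters w) 0 n) && p w] = (\sum_(0 <= k <oo) P (G k p))%E.
  move=> mp; rewrite UG measure_bigcup//; last by move=> k _; apply: mG.
  by apply: eq_eseriesl => k; exact: mem_set.
have mT : measurable [set w : Omega | (fun=> true) w].
  by rewrite (_ : [set _ | _] = setT)//; apply/seteqP; split.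
have mD (p : Omega -> bool) : measurable [set w | p w] ->
    measurable [set w | D (segment (letters w) 0 n) && p w].
  by move=> mp; rewrite UG; apply: bigcupT_measurable => k; apply: mG.
have DT : [set w | D (segment (letters w) 0 n)] =
    [set w | D (segment (letters w) 0 n) && (fun=> true) w].
  by apply/seteqP; split => w /=; rewrite andbT.
have mDT : measurable [set w | D (segment (letters w) 0 n)].
  by rewrite DT; apply: mD.
split => //; apply: EFin_inj; rewrite EFinM -!probK//; last exact: mD.
rewrite DT !PG// muleC -nneseriesZl//; apply: eq_eseriesr => k _.
have [H|[v vn H]] := GE k; first by rewrite !H !measure0 mule0.
have mv := measurable_segment_eq 0 n v.
rewrite !H probK; last exact: measurable_andb.
rewrite qc// EFinM muleC -probK//; congr (_ * P _)%E.
by apply/seteqP; split => w /=; rewrite andbT.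
Qed.

Lemma measurable_segment_event n (D : pred (seq Sigma)) :
  measurable [set w | D (segment (letters w) 0 n)].
Proof.
have mT : measurable [set w : Omega | (fun=> true) w].
  by rewrite (_ : [set _ | _] = setT)//; apply/seteqP; split.
apply: proj1 (@segment_event_indep n D (fun=> true) 1 mT _) => v _.
by rewrite mulr1; apply: eq_prob => w; rewrite andbT.
Qed.

Lemma prob_segment_event n (D : pred (seq Sigma)) v :
  prob P (fun w => D (segment (letters w) 0 n) &&
                   (segment (letters w) n (size v) == v)) =
  prob P (fun w => D (segment (letters w) 0 n)) * word_prob P X v.
Proof.
apply: proj2 (@segment_event_indep n D _ _ (measurable_segment_eq n (size v) v) _).
move=> u un; rewrite -un prob_segment -word_prob_cat -(prob_segment 0).
apply: eq_prob => w.
by rewrite size_cat segmentD eqseq_cat ?size_segment.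
Qed.

End Letters.

(** * The random text and the waiting times *)

Section Stream.
Variable T : eqType.
Implicit Types (A : seq T) (x : nat -> T).

(** The default value of [nth] is what continues [A]: beyond its last letter the
    stream reads [x]. *)
Definition stream A x n : T := nth (x (n - size A)%N) A n.

Lemma segment_stream_after A x n r :
  segment (stream A x) (size A + n) r = segment x n r.
Proof.
apply: eq_segment => k _.
by rewrite /stream nth_default -addnA ?leq_addr// addKn.
Qed.

Lemma segment_stream_prefix A x : segment (stream A x) 0 (size A) = A.
Proof.
case: A => // a A; apply: (@eq_from_nth _ a); rewrite ?size_segment// => k kA.
rewrite (nth_map 0%N) ?size_iota// nth_iota// /stream.
exact: set_nth_default.
Qed.

Lemma segment_stream A x n :
  segment (stream A x) 0 (size A + n) = A ++ segment x 0 n.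
Proof.
rewrite segmentD segment_stream_prefix.
by rewrite -[(0 + size A)%N]addn0 add0n segment_stream_after.
Qed.

Definition random_text (Omega : Type) A (xi : nat -> Omega -> T) (w : Omega) :
  nat -> T := stream A (fun n => xi n w).

End Stream.

Section WaitingTime.
Context (d d' : measure_display) (Omega : measurableType d)
  (Sigma : measurableType d') (R : realType).
Variables (xi : nat -> Omega -> Sigma) (m : nat) (B : 'I_m -> seq Sigma).
Variable A : seq Sigma.
Hypothesis B_nil : forall i, B i != [::].
Hypothesis B_reduced : forall i j, i != j -> ~~ infix (B i) (B j).
Hypothesis B_notin_A : forall i, ~~ infix (B i) (take (size A).-1 A).
Implicit Types (w : Omega) (b : seq Sigma) (i j : 'I_m).

Let W := random_text A xi.
Let l := size A.

Lemma avoids_initial w n : (n <= l.-1)%N -> avoids B (segment (W w) 0 n).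
Proof.
move=> nl; apply: (avoids_segment nl).
rewrite -(take_segment _ _ (leq_pred l)) segment_stream_prefix.
exact/forallP.
Qed.

Lemma first_hit_after_initial w j n :
  first_hit B j (segment (W w) 0 n) -> (l <= n)%N.
Proof.
rewrite first_hit_segment => /andP[bj _]; rewrite leqNgt; apply/negP => nl.
have /forallP/(_ j) : avoids B (segment (W w) 0 n) by apply: avoids_initial; lia.
by rewrite bj.
Qed.

Lemma waiting_timeE w b : waiting_time R xi A b w =
  ereal_inf [set k%:R%:E | k in [set k | infix b (segment (W w) 0 (l + k))]].
Proof.
rewrite /waiting_time; congr (ereal_inf (_ @` _)).
by apply/seteqP; split => k /=; rewrite segment_stream.
Qed.

Lemma waiting_time_ge w b n :
  (forall k, infix b (segment (W w) 0 (l + k)) -> (n <= k)%N) ->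
  (n%:R%:E <= waiting_time R xi A b w)%E.
Proof.
move=> H; rewrite waiting_timeE; apply/ereal_infP => _ [k /= /H nk <-].
by rewrite lee_fin ler_nat.
Qed.

Lemma waiting_time_le w b n : infix b (segment (W w) 0 (l + n)) ->
  (waiting_time R xi A b w <= n%:R%:E)%E.
Proof.
by move=> bn; rewrite waiting_timeE; apply: ge_ereal_inf; exists n%:R%:E => //; exists n.
Qed.

Lemma avoids_infix_lt w j n k : avoids B (segment (W w) 0 n) ->
  infix (B j) (segment (W w) 0 k) -> (n < k)%N.
Proof.
move=> /forallP/(_ j) av bk; rewrite ltnNge; apply: contra av => kn.
exact: infix_segment bk.
Qed.

Lemma first_hit_waiting_time_ge w j j' n : first_hit B j (segment (W w) 0 (l + n)) ->
  (n%:R%:E <= waiting_time R xi A (B j') w)%E.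
Proof.
rewrite first_hit_segment => /andP[_ av]; apply: waiting_time_ge => k.
by move=> /(avoids_infix_lt av); lia.
Qed.

Lemma first_hit_waiting_time w j n : first_hit B j (segment (W w) 0 (l + n)) ->
  waiting_time R xi A (B j) w = n%:R%:E.
Proof.
move=> hj; apply/eqP; rewrite eq_le (first_hit_waiting_time_ge _ hj) andbT.
by move: hj; rewrite first_hit_segment => /andP[bj _]; apply: waiting_time_le.
Qed.

Lemma first_hit_waiting_time_coll w j n :
  first_hit B j (segment (W w) 0 (l + n)) ->
  waiting_time_coll R xi A B w = n%:R%:E.
Proof.
move=> hj; apply/eqP; rewrite eq_le; apply/andP; split.
  by rewrite -(first_hit_waiting_time hj); apply: bigmin_le.
by apply: le_bigmin => [|j' _]; [rewrite leey|apply: first_hit_waiting_time_ge hj].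
Qed.

(** A pattern whose waiting time is n has occurred at position l + n but not
    earlier, since nothing has: it is completed by the same letter as [B j]. *)
Lemma first_hit_waiting_time_eq w j j' n :
  first_hit B j (segment (W w) 0 (l + n)) ->
  waiting_time R xi A (B j') w = n%:R%:E -> j' = j.
Proof.
move=> hj ej'; have [bj'|nbj'] := boolP (infix (B j') (segment (W w) 0 (l + n))).
  apply: (first_hit_pattern B_nil B_reduced _ hj); rewrite first_hit_segment bj'.
  by move: hj; rewrite first_hit_segment => /andP[].
suff : (n.+1%:R%:E <= waiting_time R xi A (B j') w)%E.
  by rewrite ej' lee_fin ler_nat ltnn.
move: hj; rewrite first_hit_segment => /andP[_ av].
apply: waiting_time_ge => k bk; rewrite ltn_neqAle.
apply/andP; split; first by apply: contraNneq nbj' => ->.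
by move: (avoids_infix_lt av bk); lia.
Qed.

Lemma no_hit_waiting_time w :
  (forall j n, ~~ first_hit B j (segment (W w) 0 (l + n))) ->
  waiting_time_coll R xi A B w = +oo%E.
Proof.
move=> nh; apply: bigmin_eq_id => j _.
rewrite waiting_timeE (_ : [set _ | _ in _] = set0) ?ereal_inf0//.
rewrite -subset0 => _ [k /= bk _].
have [||j' [r [_ hr]]] := @first_hit_before _ _ B (W w) 0 (l + k).
- by apply: avoids_initial.
- by apply/avoidsPn; exists j.
have lr := first_hit_after_initial hr.
by have := nh j' (r - l)%N; rewrite subnKC// hr.
Qed.

Variable alpha : R.
Hypothesis alpha_gt0 : 0 < alpha.

Lemma pow_time_first_hit w j n : first_hit B j (segment (W w) 0 (l + n)) ->
  pow_time alpha (waiting_time_coll R xi A B w) = alpha ^+ n.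
Proof.
by move=> /first_hit_waiting_time_coll ->; rewrite /= powR_mulrn// ltW.
Qed.

Lemma pow_time_no_hit w :
  (forall j n, ~~ first_hit B j (segment (W w) 0 (l + n))) ->
  pow_time alpha (waiting_time_coll R xi A B w) = 0.
Proof. by move=> /no_hit_waiting_time ->. Qed.

Lemma pow_time_on_first_hit w j n : first_hit B j (segment (W w) 0 (l + n)) ->
  pow_time alpha (waiting_time_coll R xi A B w) *
    \1_[set w' | waiting_time_coll R xi A B w' = waiting_time R xi A (B j) w'] w =
  alpha ^+ n.
Proof.
move=> hj; rewrite (pow_time_first_hit hj) indicE mem_set ?mulr1//=.
by rewrite (first_hit_waiting_time hj) (first_hit_waiting_time_coll hj).
Qed.

(** Either another pattern is hit first, so that [B j] is strictly later, or no
    pattern ever occurs and all waiting times are infinite. *)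
Lemma pow_time_on_no_hit w j :
  (forall n, ~~ first_hit B j (segment (W w) 0 (l + n))) ->
  pow_time alpha (waiting_time_coll R xi A B w) *
    \1_[set w' | waiting_time_coll R xi A B w' = waiting_time R xi A (B j) w'] w =
  0.
Proof.
move=> nh.
have [[j' [n hj']]|nh'] :=
    pselect (exists j' n, first_hit B j' (segment (W w) 0 (l + n))).
  rewrite indicE memNset ?mulr0//= (first_hit_waiting_time_coll hj') => ej.
  have /esym jj' := first_hit_waiting_time_eq hj' (esym ej).
  by have := nh n; rewrite -jj' hj'.
rewrite pow_time_no_hit ?mul0r// => j' n; apply/negP => hj'.
by apply: nh'; exists j', n.
Qed.

End WaitingTime.

(** * Probabilities of first hits and generating functions *)

Lemma big_nat_shift (V : nmodType) (F : nat -> V) k n :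
  \sum_(k <= q < k + n) F q = \sum_(0 <= q < n) F (k + q)%N.
Proof.
rewrite -{1}[k]add0n big_addn addKn.
by apply: eq_bigr => q _; rewrite addnC.
Qed.

Section GeneratingFunctions.
Context (d d' : measure_display) (Omega : measurableType d)
  (Sigma : measurableType d') (R : realType) (P : probability Omega R).
Hypothesis mSigma : forall a : Sigma, measurable [set a].
Variables (X : {dRV P >-> Sigma}) (xi : nat -> {RV P >-> Sigma}).
Hypothesis X_gt0 : forall a : Sigma, (0 < P (X @^-1` [set a]))%E.
Hypothesis xi_iid : iid_copies X xi.
Variables (m : nat) (B : 'I_m -> seq Sigma) (A : seq Sigma).
Hypothesis B_nil : forall i, B i != [::].
Hypothesis B_reduced : forall i j, i != j -> ~~ infix (B i) (B j).
Hypothesis B_notin_A : forall i, ~~ infix (B i) (take (size A).-1 A).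
Implicit Types (i j : 'I_m).

Let W := random_text A xi.
Let l := size A.

Lemma measurable_stream_event n (D : pred (seq Sigma)) :
  measurable [set w | D (segment (W w) 0 n)].
Proof.
have := measurable_segment_event mSigma xi X_gt0 n (fun v => D (take n (A ++ v))).
rewrite (_ : [set _ | _] = [set w | D (segment (W w) 0 n)])//.
apply/seteqP; split => w /=.
  by rewrite -segment_stream take_segment ?leq_addl.
by rewrite -segment_stream take_segment ?leq_addl.
Qed.

Lemma measurable_stream_block n r (v : seq Sigma) :
  measurable [set w | segment (W w) n r == v].
Proof.
have := measurable_stream_event (n + r) (fun u => drop n u == v).
rewrite (_ : [set _ | _] = [set w | segment (W w) n r == v])//.
by apply/seteqP; split => w /=; rewrite drop_segment ?leq_addr// add0n addKn.
Qed.

Lemma prob_stream_event n (D : pred (seq Sigma)) v :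
  prob P (fun w => D (segment (W w) 0 (l + n)) &&
                   (segment (W w) (l + n) (size v) == v)) =
  prob P (fun w => D (segment (W w) 0 (l + n))) * word_prob P X v.
Proof.
have E : (fun w => D (segment (W w) 0 (l + n))) =1
    (fun w => D (A ++ segment (fun k => xi k w) 0 n)).
  by move=> w; rewrite segment_stream.
rewrite (eq_prob _ E) -(prob_segment_event mSigma X_gt0 xi_iid n (fun u => D (A ++ u))).
by apply: eq_prob => w; rewrite segment_stream_after E.
Qed.

Definition hit_prob j n : R := prob P (fun w => first_hit B j (segment (W w) 0 n)).

Definition avoid_prob n : R := prob P (fun w => avoids B (segment (W w) 0 n)).

Lemma hit_prob_early j n : (n < size (B j))%N || (n < l)%N -> hit_prob j n = 0.
Proof.
move=> nj; apply: prob_false => w; apply: contraL nj => hj.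
rewrite negb_or -!leqNgt; apply/andP.
split; last exact: (first_hit_after_initial B_notin_A hj).
by have := size_suffix (first_hit_suffix B_nil hj); rewrite size_segment.
Qed.

Lemma prob_hit_block j n v :
  prob P (fun w => first_hit B j (segment (W w) 0 n) &&
                   (segment (W w) n (size v) == v)) =
  hit_prob j n * word_prob P X v.
Proof.
have [nl|ln] := ltnP n l.
  rewrite hit_prob_early ?nl ?orbT// mul0r; apply: prob_false => w.
  apply/negP => /andP[/(first_hit_after_initial B_notin_A)].
  by rewrite leqNgt nl.
by rewrite -(subnKC ln) prob_stream_event.
Qed.

Lemma avoid_prob_initial n : (n <= l.-1)%N -> avoid_prob n = 1.
Proof. by move=> nl; apply: prob_true => w; apply: avoids_initial. Qed.

Lemma avoid_prob_pred n :
  avoid_prob n.-1 = avoid_prob n + \sum_(j < m) hit_prob j n.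
Proof.
pose h (o : option 'I_m) w := if o is Some j
  then first_hit B j (segment (W w) 0 n) else avoids B (segment (W w) 0 n).
rewrite /avoid_prob (@prob_sum _ _ _ _ _ (None :: map some (index_enum 'I_m)) _ h).
- by rewrite big_cons big_map.
- by case=> [j|]; [exact: (measurable_stream_event n (first_hit B j))|
                   exact: (measurable_stream_event n (avoids B))].
- by move=> w; rewrite big_cons big_map first_hit_sum.
Qed.

Lemma exists_hit_prob n :
  prob P (fun w => [exists j, first_hit B j (segment (W w) 0 n)]) =
  \sum_(j < m) hit_prob j n.
Proof.
rewrite (@prob_sum _ _ _ P _ (index_enum 'I_m) _
  (fun j w => first_hit B j (segment (W w) 0 n)))// => [j|w].
  exact: (measurable_stream_event n (first_hit B j)).
have [/existsP[j hj]|nh] := boolP [exists j, first_hit B j (segment (W w) 0 n)].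
  rewrite (bigD1 j)//= hj big1// => j' jj'; apply/eqP; rewrite eqb0.
  by apply: contraNN jj' => /(first_hit_pattern B_nil B_reduced)/(_ hj) ->.
rewrite big1// => j _; apply/eqP; rewrite eqb0; apply: contra nh => hj.
by apply/existsP; exists j.
Qed.

Section Series.
Variable alpha : R.
Hypotheses (alpha_gt0 : 0 < alpha) (alpha_lt1 : alpha < 1).

Let tau_ j := waiting_time R xi A (B j).
Let tau := waiting_time_coll R xi A B.

Lemma cvg_pgf_on j :
  \sum_(0 <= n < N) alpha ^+ n * hit_prob j (l + n) @[N --> \oo] -->
  pgf_on P tau (tau_ j) alpha.
Proof.
apply: (@cvg_expectation_pow _ _ _ _
  (fun n w => first_hit B j (segment (W w) 0 (l + n)))) => [|n|w n k|w n|w].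
- by rewrite alpha_gt0.
- exact: (measurable_stream_event (l + n) (first_hit B j)).
- by move=> /first_hit_time h /h; lia.
- exact: pow_time_on_first_hit.
- exact: pow_time_on_no_hit.
Qed.

Lemma cvg_pgf :
  \sum_(0 <= n < N) alpha ^+ n * (\sum_(j < m) hit_prob j (l + n)) @[N --> \oo]
    --> pgf P tau alpha.
Proof.
under eq_fun do under eq_bigr do rewrite -exists_hit_prob.
apply: (@cvg_expectation_pow _ _ _ _
  (fun n w => [exists j, first_hit B j (segment (W w) 0 (l + n))])) => [|n|w n k|w n|w].
- by rewrite alpha_gt0.
- exact: (measurable_stream_event (l + n) (fun v => [exists j, first_hit B j v])).
- by move=> /existsP[j /first_hit_time h] /existsP[j' /h]; lia.
- by move=> /existsP[j]; apply: pow_time_first_hit.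
- move=> nh; apply: pow_time_no_hit => // j n.
  by have := nh n; rewrite negb_exists => /forallP.
Qed.

(** Summation by parts.  The last factor is Pr(tau >= N), as tau >= N says that
    nothing has occurred one position before l + N; when l = N = 0 this position
    is again 0 and the factor is 1, as it should be. *)
Lemma avoid_prob_sum N :
  (1 - alpha) * \sum_(0 <= n < N) alpha ^+ n * avoid_prob (l + n) =
  1 - \sum_(0 <= n < N) alpha ^+ n * (\sum_(j < m) hit_prob j (l + n)) -
  alpha ^+ N * avoid_prob (l + N).-1.
Proof.
elim: N => [|N IH].
  by rewrite !big_geq// addn0 avoid_prob_initial// expr0; ring.
rewrite !big_nat_recr//= mulrDr IH addnS/= avoid_prob_pred exprS; ring.
Qed.

Lemma cvg_Qgf :
  \sum_(0 <= n < N) alpha ^+ n * avoid_prob (l + n) @[N --> \oo] -->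
  Qgf P tau alpha.
Proof.
have a1 : 1 - alpha != 0 by rewrite subr_eq0 gt_eqF.
rewrite (_ : (fun N => _) = fun N =>
  (1 - \sum_(0 <= n < N) alpha ^+ n * (\sum_(j < m) hit_prob j (l + n)) -
  alpha ^+ N * avoid_prob (l + N).-1) / (1 - alpha)); last first.
  by apply/funext => N; rewrite -avoid_prob_sum mulrAC mulfV// mul1r.
apply: cvgMl; rewrite -[X in _ --> X]subr0; apply: cvgB.
  by apply: cvgB; [exact: cvg_cst | exact: cvg_pgf].
have /cvg_expr a0 : `|alpha| < 1 by rewrite gtr0_norm.
apply: (squeeze_cvgr _ (cvg_cst 0) a0); near=> N.
have mav : measurable [set w | avoids B (segment (W w) 0 (l + N).-1)].
  exact: (measurable_stream_event _ (avoids B)).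
have aN : 0 <= alpha ^+ N by rewrite exprn_ge0// ltW.
apply/andP; split; first by rewrite mulr_ge0// prob_ge0.
by rewrite ler_piMr ?prob_le1// exprn_ge0// ltW.
Unshelve. all: by end_near.
Qed.

(** Shifting positions by k loses nothing, since hits of [B j] cannot occur
    before position |B j| >= k; those before position l do not occur either. *)
Lemma cvg_hit_shift j k : (k <= size (B j))%N ->
  \sum_(0 <= q < l + N) alpha ^+ q * hit_prob j (q + k) @[N --> \oo] -->
  alpha ^+ l * (alpha ^+ k)^-1 * pgf_on P tau (tau_ j) alpha.
Proof.
move=> kj.
have ak : alpha ^+ k != 0 by rewrite expf_neq0// gt_eqF.
have E N : \sum_(0 <= q < l + N) alpha ^+ q * hit_prob j (q + k) =
    alpha ^+ l * (alpha ^+ k)^-1 *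
    \sum_(0 <= n < N + k) alpha ^+ n * hit_prob j (l + n).
  pose F q := alpha ^+ q * hit_prob j q.
  transitivity ((alpha ^+ k)^-1 * \sum_(0 <= q < l + (N + k)) F q).
    have kl : (k <= l + (N + k))%N by rewrite addnA leq_addl.
    rewrite (big_cat_nat _ kl)//=.
    rewrite [X in X + _]big_nat_cond [X in X + _]big1 ?add0r; last first.
      move=> q /andP[/andP[_ qk] _].
      by rewrite /F hit_prob_early ?mulr0// (leq_trans qk kj).
    rewrite addnA [(_ + k)%N]addnC [X in _ * X]big_nat_shift mulr_sumr.
    by apply: eq_bigr => q _; rewrite /F exprD [(k + q)%N]addnC; field.
  rewrite (big_cat_nat _ (leq_addr _ l))//=.
  rewrite [X in X + _]big_nat_cond [X in X + _]big1 ?add0r; last first.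
    by move=> q /andP[/andP[_ ql] _]; rewrite /F hit_prob_early ?mulr0// ql orbT.
  rewrite [X in _ * X = _]big_nat_shift !mulr_sumr.
  by apply: eq_bigr => n _; rewrite /F exprD; ring.
under eq_fun do rewrite E.
apply: cvgMr.
have := @cvg_pgf_on j; rewrite -(cvg_shiftn k).
exact.
Qed.

End Series.

(** Dividing by the probability of [B i] is what makes both evaluations of this
    quantity below produce coefficients of correlations. *)
Definition occurrence_scaled i q : R :=
  prob P (fun w => avoids B (segment (W w) 0 q) &&
                   (segment (W w) q (size (B i)) == B i)) / word_prob P X (B i).

Lemma occurrence_scaledE i q : occurrence_scaled i q =
  \sum_(j < m) \sum_(1 <= k < (minn (size (B j)) (size (B i))).+1)
    (drop (size (B j) - k) (B j) == take k (B i))%:R /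
      word_prob P X (take k (B i)) * hit_prob j (q + k).
Proof.
rewrite /occurrence_scaled; set b := size (B i).
pose h (s : 'I_m * nat) w :=
  [&& first_hit B s.1 (segment (W w) 0 (q + s.2)),
      drop (size (B s.1) - s.2) (B s.1) == take s.2 (B i) &
      segment (W w) (q + s.2) (b - s.2) == drop s.2 (B i)].
pose r := [seq (j, k) | j <- index_enum 'I_m,
                        k <- index_iota 1 (minn (size (B j)) b).+1].
rewrite (@prob_sum _ _ _ _ _ r _ h).
- rewrite big_allpairs_dep mulr_suml; apply: eq_bigr => j _.
  rewrite mulr_suml big_nat_cond [RHS]big_nat_cond.
  apply: eq_bigr => k /andP[/andP[k0 kb] _].
  have {}kb : (k <= b)%N by move: kb; rewrite ltnS leq_min => /andP[].
  rewrite -[in word_prob P X (B i)](cat_take_drop k (B i)) word_prob_cat.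
  have u0 := lt0r_neq0 (word_prob_gt0 mSigma X_gt0 (take k (B i))).
  have v0 := lt0r_neq0 (word_prob_gt0 mSigma X_gt0 (drop k (B i))).
  case: eqVneq => [E|nE]; last first.
    rewrite !mul0r prob_false ?mul0r// => w.
    by rewrite /h /= (negbTE nE) andbF.
  have -> : prob P (h (j, k)) = hit_prob j (q + k) * word_prob P X (drop k (B i)).
    rewrite -prob_hit_block; apply: eq_prob => w.
    by rewrite /h/= E eqxx size_drop.
  by rewrite mulr1n; field; rewrite u0 v0.
- move=> [j k]; apply: measurable_andb.
    exact: (measurable_stream_event _ (first_hit B j)).
  case: (_ == _) => /=; first exact: measurable_stream_block.
  by rewrite (_ : [set _ | _] = set0)//; apply/seteqP; split.
- by move=> w; rewrite big_allpairs_dep; apply: occurrence_decomposition.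
Qed.

Lemma occurrence_scaled_late i n :
  occurrence_scaled i (l + n) = avoid_prob (l + n).
Proof.
rewrite /occurrence_scaled prob_stream_event mulfK//.
exact: lt0r_neq0 (word_prob_gt0 mSigma X_gt0 _).
Qed.

(** When k exceeds |B i| the occurrence would end before the last letter of A,
    which is excluded; otherwise it consists of the last k letters of A followed
    by |B i| - k fresh letters. *)
Lemma occurrence_scaled_early i k : (0 < k <= l)%N ->
  occurrence_scaled i (l - k) =
  if (k <= size (B i))%N then
    (drop (l - k) A == take k (B i))%:R / word_prob P X (take k (B i))
  else 0.
Proof.
rewrite /occurrence_scaled => /andP[k0 kl]; case: leqP => [kb|bk]; last first.
  rewrite prob_false ?mul0r// => w; apply/negP => /andP[_ /eqP bi].
  have /forallP/(_ i) : avoids B (segment (W w) 0 (l - k + size (B i))).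
    by apply: avoids_initial => //; rewrite -/l; lia.
  by rewrite segmentD bi suffixW ?suffix_suffix.
rewrite -[in word_prob P X (B i)](cat_take_drop k (B i)) word_prob_cat.
have u0 := lt0r_neq0 (word_prob_gt0 mSigma X_gt0 (take k (B i))).
have v0 := lt0r_neq0 (word_prob_gt0 mSigma X_gt0 (drop k (B i))).
have E w : avoids B (segment (W w) 0 (l - k)) &&
    (segment (W w) (l - k) (size (B i)) == B i) =
    (drop (l - k) A == take k (B i)) &&
    (segment (fun n => xi n w) 0 (size (drop k (B i))) == drop k (B i)).
  rewrite avoids_initial//=; last by rewrite -/l; lia.
  rewrite -{1}(subnKC kb) segmentD subnK// -[X in segment _ X (_ - _)]addn0.
  rewrite segment_stream_after -[X in _ == X](cat_take_drop k (B i)).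
  rewrite eqseq_cat ?size_segment ?size_takel// size_drop.
  congr ((_ == _) && _).
  by rewrite -[in RHS](segment_stream_prefix A (fun n => xi n w))
    drop_segment ?leq_subr// add0n subKn.
rewrite (eq_prob _ E); case: eqP => _ /=; last by rewrite prob_false// !mul0r.
by rewrite (prob_segment mSigma xi_iid) mulr1n; field; rewrite u0 v0.
Qed.

Lemma occurrence_sum i alpha N : 0 < alpha ->
  \sum_(0 <= q < l + N) alpha ^+ q * occurrence_scaled i q =
  alpha ^+ l * (correlation P X A (B i) alpha +
     \sum_(0 <= n < N) alpha ^+ n * avoid_prob (l + n)).
Proof.
move=> a0; rewrite (big_cat_nat _ (leq_addr _ _))//= mulrDr.
congr (_ + _); last first.
  rewrite big_nat_shift mulr_sumr; apply: eq_bigr => n _.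
  by rewrite occurrence_scaled_late exprD mulrA.
(* Positions q < l are indexed by k = l - q, the length of the final part of A
   from which the occurrence of B i starts; this k is at least 1. *)
rewrite big_nat_rev.
rewrite -[X in \sum_(0 <= _ < X) _]/(l.+1.-1) -(big_add1 _ _ 0 l.+1 xpredT
  (fun k => alpha ^+ (0 + l - k) * occurrence_scaled i (0 + l - k))).
rewrite (@big_cat_nat _ _ _ (minn l (size (B i))).+1)//=; last first.
  by rewrite ltnS geq_minl.
rewrite [X in _ + X]big_nat_cond [X in _ + X]big1 ?addr0; last first.
  move=> k /andP[/andP[kb kl] _]; rewrite add0n occurrence_scaled_early; last by lia.
  by rewrite ifF ?mulr0//; lia.
rewrite mulr_sumr big_nat_cond [RHS]big_nat_cond.
apply: eq_bigr => k /andP[/andP[k0 kb] _].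
have {kb}[kl kb] : (k <= l)%N /\ (k <= size (B i))%N by lia.
rewrite add0n occurrence_scaled_early ?k0// kb.
have u0 := lt0r_neq0 (word_prob_gt0 mSigma X_gt0 (take k (B i))).
have ak : alpha ^+ k != 0 by rewrite expf_neq0// gt_eqF.
have -> : alpha ^+ l = alpha ^+ (l - k) * alpha ^+ k by rewrite -exprD subnK.
by rewrite -/l; field; rewrite ak u0.
Qed.

End GeneratingFunctions.

Theorem proposition3p1 (d d' : measure_display)
  (Omega : measurableType d) (Sigma : measurableType d')
  (mSigma : forall a : Sigma, measurable [set a])
  (R : realType) (P : probability Omega R)
  (X : {dRV P >-> Sigma})
  (X_gt0 : forall a : Sigma, (0 < P (X @^-1` [set a]))%E)
  (xi : nat -> {RV P >-> Sigma})
  (xi_iid : iid_copies X xi)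
  (m : nat) (B : 'I_m -> seq Sigma)
  (B_reduced : forall i j : 'I_m, i != j -> ~~ infix (B i) (B j))
  (A : seq Sigma)
  (B_notin_A : forall i : 'I_m, ~~ infix (B i) (take (size A).-1 A))
  (i : 'I_m) (alpha : R) (alpha_gt0 : 0 < alpha) (alpha_lt1 : alpha < 1) :
  let tau_ (j : 'I_m) := waiting_time R xi A (B j) in
  let tau := waiting_time_coll R xi A B in
  let g (j : 'I_m) := pgf_on P tau (tau_ j) alpha in
  - Qgf P tau alpha + \sum_(j < m) correlation P X (B j) (B i) alpha * g j
    = correlation P X A (B i) alpha.
Proof.
move=> tau_ tau g.
have B_nil j : B j != [::].
  by apply: contraNneq (B_notin_A j) => ->; rewrite infix0s.
have al : alpha ^+ size A != 0 by rewrite expf_neq0// gt_eqF.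
pose S N := \sum_(0 <= q < size A + N) alpha ^+ q * occurrence_scaled X xi B A i q.
(* The generating function of the occurrences, computed in two ways. *)
have cvgQ : S N @[N --> \oo] -->
    alpha ^+ size A * (correlation P X A (B i) alpha + Qgf P tau alpha).
  rewrite /S; under eq_fun do rewrite occurrence_sum//.
  apply: cvgMr; apply: cvgD; first exact: cvg_cst.
  exact: cvg_Qgf.
have cvgg : S N @[N --> \oo] -->
    \sum_(j < m) \sum_(1 <= k < (minn (size (B j)) (size (B i))).+1)
    (drop (size (B j) - k) (B j) == take k (B i))%:R /
      word_prob P X (take k (B i)) *
      (alpha ^+ size A * (alpha ^+ k)^-1 * g j).
  have -> : S = fun N => \sum_(j < m)
      \sum_(1 <= k < (minn (size (B j)) (size (B i))).+1)
      (drop (size (B j) - k) (B j) == take k (B i))%:R /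
      word_prob P X (take k (B i)) *
      \sum_(0 <= q < size A + N) alpha ^+ q * hit_prob xi B A j (q + k).
    apply/funext => N; rewrite /S.
    under eq_bigr => q _ do rewrite occurrence_scaledE// mulr_sumr.
    rewrite exchange_big/=; apply: eq_bigr => j _.
    under eq_bigr => q _ do rewrite mulr_sumr.
    rewrite exchange_big/=; apply: eq_bigr => k _.
    by rewrite mulr_sumr; apply: eq_bigr => q _; rewrite mulrCA.
  apply: cvg_big => [|j _]; first exact: add_continuous.
  under eq_fun do rewrite big_nat_cond.
  rewrite big_nat_cond; apply: cvg_big => [|k]; first exact: add_continuous.
  rewrite ltnS leq_min => /andP[/and3P[_ kj _] _].
  by apply: cvgMr; apply: (cvg_hit_shift mSigma X_gt0).
have {cvgQ cvgg} E := cvg_unique (@norm_hausdorff _ R) cvgQ cvgg.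
suff -> : \sum_(j < m) correlation P X (B j) (B i) alpha * g j =
    correlation P X A (B i) alpha + Qgf P tau alpha by rewrite addrC addrK.
apply: (mulfI al); rewrite E mulr_sumr; apply: eq_bigr => j _.
rewrite /correlation mulr_suml mulr_sumr; apply: eq_bigr => k _.
by rewrite invfM; ring.
Qed.
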